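(* Let $n\ge 2$ be an integer, let $a_1,\dots,a_n,b_1,\dots,b_n$ be real numbers, and let $$q(s)=s^{n}+\sum_{j=1}^{n}(a_j+i\,b_j)\,s^{n-j}.$$ Let $a_1^{(1)},a_2^{(2)},\dots,a_n^{(n)}$ be the real numbers produced from these coefficients by the generalized Routh–Hurwitz recursion given in the context. Then all the roots of $q$ lie in the open left half-plane $\{s\in\mathbb{C}:\operatorname{Re}(s)<0\}$ if and only if $a_k^{(k)}>0$ for all $k=1,\dots,n$.
   Context: Here $i$ is the imaginary unit. The generalized Routh–Hurwitz recursion is as follows. Convention: $a_{n+1}=b_{n+1}=0$, and $a_{n+1}^{(p)}=b_{n+1}^{(p)}=0$ for every $p$. For each $p=1,\dots,n-1$ one defines real numbers $a_k^{(p)}$ and $b_k^{(p)}$ for all $k=p,\dots,n$. Initialization ($p=1$). - First row: $a_k^{(1)}=a_k$ for odd $k$, and $b_k^{(1)}=b_k$ for even $k$, $1\le k\le n$. - Second row: $b_k^{(1)}=a_1b_k-b_{k+1}$ for odd $k$, and $a_k^{(1)}=a_1a_k-a_{k+1}$ for even $k$, $1\le k\le n$. Step $p$, for $p=2,\dots,n-1$. - First row: for $p\le k\le n$ with $k\equiv p \pmod 2$, $$a_k^{(p)}=a_{p-1}^{(p-1)}a_k^{(p-1)}+b_{p-1}^{(p-1)}b_k^{(p-1)};$$ for $p+1\le k\le n$ with $k\not\equiv p\pmod 2$, $$b_k^{(p)}=a_{p-1}^{(p-1)}b_k^{(p-1)}-b_{p-1}^{(p-1)}a_k^{(p-1)}.$$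 - Second row: for $p\le k\le n$ with $k\equiv p\pmod 2$, $$b_k^{(p)}=a_p^{(p)}b_k^{(p-1)}-a_{p-1}^{(p-1)}b_{k+1}^{(p)};$$ for $p+1\le k\le n$ with $k\not\equiv p\pmod 2$, $$a_k^{(p)}=a_p^{(p)}a_k^{(p-1)}-a_{p-1}^{(p-1)}a_{k+1}^{(p)}.$$ Final step: $$a_n^{(n)}=a_{n-1}^{(n-1)}a_n^{(n-1)}+b_{n-1}^{(n-1)}b_n^{(n-1)}.$$ *)

(* Defs.v *)
From HB Require Import structures.
From mathcomp Require Import all_boot all_order all_algebra.
From mathcomp Require Import complex.
From mathcomp Require Import reals.

Set Implicit Arguments.
Unset Strict Implicit.
Unset Printing Implicit Defensive.

Import Order.TTheory GRing.Theory Num.Theory.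

Local Open Scope ring_scope.
Local Open Scope complex_scope.

(* Coefficient sequences are total functions on nat, of which only the values
   at 1, ..., n matter: [poly_of_coefs] and [rh_table] read no others. *)
Definition poly_of_coefs (R : realType) (n : nat) (a b : nat -> R) :
    {poly R[i]} :=
  'X^n + \sum_(1 <= j < n.+1) (a j +i* b j) *: 'X^(n - j).

(* Setting entries to 0 outside the range p <= k <= n implements the
   convention that every entry of index n + 1 vanishes. *)
Definition trunc_seq (R : realType) (p n : nat) (f : nat -> R) : nat -> R :=
  fun k => if (p <= k <= n)%N then f k else 0.

Definition rh_init (R : realType) (n : nat) (a b : nat -> R) :
    (nat -> R) * (nat -> R) :=
  let a0 := trunc_seq 1 n a in
  let b0 := trunc_seq 1 n b in
  (trunc_seq 1 n (fun k => if odd k then a0 k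
                           else a0 1%N * a0 k - a0 k.+1),
   trunc_seq 1 n (fun k => if odd k then a0 1%N * b0 k - b0 k.+1
                           else b0 k)).

(* [A], [B] are the sequences of step p - 1.  [A1 k] is the first-row entry
   a_k^(p) when k = p mod 2, and [B1 k] the first-row entry b_k^(p) when
   k <> p mod 2; they are used only at indices of that parity. *)
Definition rh_step (R : realType) (n p : nat) (AB : (nat -> R) * (nat -> R)) :
    (nat -> R) * (nat -> R) :=
  let: (A, B) := AB in
  let A1 := trunc_seq p n (fun k => A p.-1 * A k + B p.-1 * B k) in
  let B1 := trunc_seq p n (fun k => A p.-1 * B k - B p.-1 * A k) in
  (trunc_seq p n (fun k => if odd k == odd p then A1 k
                           else A1 p * A k - A p.-1 * A1 k.+1),
   trunc_seq p n (fun k => if odd k == odd p then A1 p * B k - A p.-1 * B1 k.+1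
                           else B1 k)).

(* The sequences k |-> a_k^(p) and k |-> b_k^(p).  The value at p = 0 is
   irrelevant.  The final step, which defines a_n^(n), is the first-row formula
   of [rh_step n n] at k = n. *)
Fixpoint rh_table (R : realType) (n : nat) (a b : nat -> R) (p : nat) :
    (nat -> R) * (nat -> R) :=
  match p with
  | 0%N => (fun=> 0, fun=> 0)
  | 1%N => rh_init n a b
  | p1.+1 => rh_step n p (rh_table n a b p1)
  end.

Definition rh_a (R : realType) (n : nat) (a b : nat -> R) (p k : nat) : R :=
  (rh_table n a b p).1 k.

(* Main.v *)
(** Split q = P_0 + P_1 into the part P_0 invariant under the paraconjugation
    s |-> - s^* (up to the sign (-1)^n) and the part P_1 which changes sign.  The
    rows of the table are the coefficients of the Euclidean remainders
      al_(p+1)^2 P_p = P_(p+2) + (al_(p+1) al_p s + i be_(p+1)) P_(p+1),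
    al_p being the leading coefficient of P_p (with al_0 = 1).
    If all al_p are positive, downward induction on p along this recurrence gives
    Re (P_p P_(p+1)^* ) > 0 on Re s > 0, so q has no root there; on the imaginary
    axis one of P_0, P_1 is real and the other imaginary, so a root of q would be
    a common root of all the P_p, hence of the nonzero constant P_n.
    Conversely, stability passes from P_p + P_(p+1) to P_(p+1) + P_(p+2), and
    al_(p+1) / al_p is minus the sum of the real parts of the roots of
    P_p + P_(p+1).  What has to be shown is
    Re (P_(p+1) P_(p+2)^* ) >= 0 for Re s > 0, that is
      al_p Re s |P_(p+1)|^2 <= al_(p+1) Re (P_p P_(p+1)^* ),
    which is proved by induction on the number of roots. *)

Require Import Defs.
From HB Require Import structures.
From mathcomp Require Import all_boot all_order all_algebra.
From mathcomp Require Import complex.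
From mathcomp Require Import reals.
From mathcomp Require Import ring lra zify.

Set Implicit Arguments.
Unset Strict Implicit.
Unset Printing Implicit Defensive.

Import Order.TTheory GRing.Theory Num.Theory.

Local Open Scope ring_scope.
Local Open Scope complex_scope.

(** * Real inner product on the complex plane; an inequality for left half-plane roots *)

Definition dotc (R : rcfType) (x y : R[i]) : R :=
  complex.Re x * complex.Re y + complex.Im x * complex.Im y.

Lemma dotc_ge0 (R : rcfType) (x : R[i]) : 0 <= dotc x x.
Proof. by rewrite /dotc -!expr2 addr_ge0 ?sqr_ge0. Qed.

Lemma dotc_le0 (R : rcfType) (x : R[i]) : dotc x x <= 0 -> x = 0.
Proof.
case: x => x y; rewrite /dotc /= -!expr2 => h.
have hx := sqr_ge0 x; have hy := sqr_ge0 y.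
have /eqP : x ^+ 2 = 0 by lra.
have /eqP : y ^+ 2 = 0 by lra.
by rewrite !sqrf_eq0 => /eqP -> /eqP ->.
Qed.

Lemma dotc_sqr_le (R : rcfType) (x y : R[i]) :
  dotc x y ^+ 2 <= dotc x x * dotc y y.
Proof.
case: x y => [x1 x2] [y1 y2]; rewrite /dotc /= -subr_ge0.
have := sqr_ge0 (x1 * y2 - x2 * y1).
by congr (0 <= _); ring.
Qed.

(** The effect of adding one root. The right side minus the left is (A D - s U) + w (2 s A V + D / 2
    - 2 s c), and (2 s c)^2 <= 4 s^2 U V <= 4 s A V D <= (2 s A V + D / 2)^2 by AM-GM. *)
Lemma cauchy_schwarz_step (R : rcfType) (s w A D U V c : R) :
  0 <= s -> 0 <= w -> 0 <= A -> 0 <= D -> 0 <= U -> 0 <= V ->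
  c ^+ 2 <= U * V -> s * U <= A * D ->
  s * (U + 2 * w * c + w ^+ 2 * V) <= (A + w / 2) * (D + 2 * s * w * V).
Proof.
move=> s0 w0 A0 D0 U0 V0 hc hU.
suff h : 2 * s * c <= 2 * s * A * V + D / 2.
  have : 0 <= w * (2 * s * A * V + D / 2 - 2 * s * c).
    by rewrite mulr_ge0 ?subr_ge0.
  have e : (A + w / 2) * (D + 2 * s * w * V) - s * (U + 2 * w * c + w ^+ 2 * V)
    = (A * D - s * U) + w * (2 * s * A * V + D / 2 - 2 * s * c) by field.
  by move=> ?; rewrite -subr_ge0 e addr_ge0 ?subr_ge0.
have sAV : 0 <= s * A * V by rewrite !mulr_ge0.
have R0 : 0 <= 2 * s * A * V + D / 2 by lra.
apply: (le_trans (ler_norm _)).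
rewrite -(@ler_pXn2r _ 2) ?nnegrE // real_normK ?num_real //.
have h1 : s ^+ 2 * c ^+ 2 <= s ^+ 2 * (U * V).
  by rewrite ler_wpM2l ?sqr_ge0.
have h2 : (s * V) * (s * U) <= (s * V) * (A * D).
  by rewrite ler_wpM2l ?mulr_ge0.
have h3 := sqr_ge0 (2 * s * A * V - D / 2).
nra.
Qed.

(* Up to sign, [G] is the value at [s] of the paraconjugate of the polynomial
   with roots [zs]. *)
Lemma paraconj_prod_ineq (R : rcfType) (zs : seq R[i]) (s : R[i]) :
  (forall z, z \in zs -> complex.Re z < 0) -> 0 <= complex.Re s ->
  let F := \prod_(z <- zs) (s - z) in
  let G := \prod_(z <- zs) (s + z^*) in
  let A := - \sum_(z <- zs) complex.Re z in
  let D := dotc F F - dotc G G in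
  [/\ 0 <= A, 0 <= D & complex.Re s * dotc (F - G) (F - G) <= A * D].
Proof.
move=> + s0; elim: zs => [_|z zs IH hz] /=.
  by rewrite !big_nil !subrr oppr0 mul0r /dotc /= !(mul0r, addr0, mulr0) !lexx.
have {hz}[z0 /IH /=] : complex.Re z < 0 /\
    (forall z', z' \in zs -> complex.Re z' < 0).
  by split=> [|z' h]; apply: hz; rewrite inE ?eqxx ?h ?orbT.
rewrite !big_cons.
move: (\prod_(z <- zs) (s - z)) (\prod_(z <- zs) (s + z^*)) => F G.
move: (\sum_(z <- zs) _) => S {IH} [A0 D0 h].
have n0 := dotc_ge0 (s - z).
have D1 : 0 <= dotc (s - z) (s - z) * (dotc F F - dotc G G) by rewrite mulr_ge0.
have [w ew] : exists w, w = - 2 * complex.Re z by exists (- 2 * complex.Re z).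
have w0 : 0 <= w by rewrite ew; lra.
have eD : dotc ((s - z) * F) ((s - z) * F) - dotc ((s + z^*) * G) ((s + z^*) * G)
   = dotc (s - z) (s - z) * (dotc F F - dotc G G) + 2 * complex.Re s * w * dotc G G.
  rewrite ew; move: s z F G {s0 z0 A0 D0 h n0 D1 w w0 ew}.
  by move=> [s1 s2] [z1 z2] [f1 f2] [g1 g2]; rewrite /dotc /=; ring.
split; first by lra.
  by rewrite eD addr_ge0 // !mulr_ge0 ?dotc_ge0.
rewrite eD.
(* The new root [z] turns F - G into u + w G with w = - 2 Re z, and A into A + w / 2. *)
pose u := (s - z) * (F - G).
have := @cauchy_schwarz_step R (complex.Re s) w (- S)
  (dotc (s - z) (s - z) * (dotc F F - dotc G G)) (dotc u u) (dotc G G) (dotc u G)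
  s0 w0 A0 D1 (dotc_ge0 _) (dotc_ge0 _) (dotc_sqr_le _ _).
have eU : dotc u u = dotc (s - z) (s - z) * dotc (F - G) (F - G).
  rewrite /u; move: s z F G {s0 z0 A0 D0 h n0 D1 w w0 ew u eD}.
  by move=> [s1 s2] [z1 z2] [f1 f2] [g1 g2]; rewrite /dotc /=; ring.
have hU : complex.Re s * dotc u u
    <= - S * (dotc (s - z) (s - z) * (dotc F F - dotc G G)).
  by rewrite eU mulrCA [leRHS]mulrCA ler_wpM2l.
move/(_ hU).
have -> : - S + w / 2 = - (complex.Re z + S) by rewrite ew; field.
apply: le_trans; rewrite le_eqVlt; apply/orP; left; apply/eqP.
congr (_ * _); rewrite /u ew.
move: s z F G {s0 z0 A0 D0 h n0 D1 w w0 ew u eD eU hU}.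
by move=> [s1 s2] [z1 z2] [f1 f2] [g1 g2]; rewrite /dotc /=; ring.
Qed.

(** * Symmetry under paraconjugation *)

(* Coefficients alternate between real (at degrees of the parity of [e]) and
   imaginary. *)
Definition para_sym (R : rcfType) (e : nat) (f : {poly R[i]}) : Prop :=
  forall i, (f`_i)^* = (-1) ^+ (e + i) * f`_i.

Lemma para_sym_horner (R : rcfType) (e : nat) (f : {poly R[i]}) (s : R[i]) :
  para_sym e f -> (f.[- s^*])^* = (-1) ^+ e * f.[s].
Proof.
move=> hf; rewrite !horner_coef rmorph_sum mulr_sumr; apply: eq_bigr => i _.
rewrite rmorphM /= hf rmorphXn rmorphN /= conjcK [(- s) ^+ i]exprNn exprD.
have : (-1) ^+ i * (-1) ^+ i = 1 :> R[i] by rewrite -expr2 sqrr_sign.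
by move: ((-1) ^+ i) => t ht; rewrite -[RHS]mulr1 -ht; ring.
Qed.

Lemma para_sym_axis (R : rcfType) (e : nat) (f g : {poly R[i]}) (s : R[i]) :
  para_sym e f -> para_sym e.+1 g -> complex.Re s = 0 ->
  f.[s] + g.[s] = 0 -> f.[s] = 0 /\ g.[s] = 0.
Proof.
move=> hf hg s0; have es : - s^* = s by case: s s0 => x y /= ->; simpc.
have := para_sym_horner s hf; have := para_sym_horner s hg; rewrite es exprS.
move: f.[s] g.[s] => u v.
have [-> | ->] : (-1) ^+ e = 1 :> R[i] \/ (-1) ^+ e = -1 :> R[i].
  by rewrite -signr_odd; case: (odd e); [right; rewrite expr1|left; rewrite expr0].
all: case: u v => [u1 u2] [v1 v2]; simpc => -[?] -[?] /eqP.
all: rewrite eq_complex /= => /andP[/eqP ? /eqP ?].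
all: split; apply/eqP; rewrite eq_complex /=; apply/andP; split; apply/eqP; lra.
Qed.

Lemma paraconj_prod (R : rcfType) (zs : seq R[i]) (s : R[i]) :
  (\prod_(z <- zs) (- s^* - z))^* = (-1) ^+ size zs * \prod_(z <- zs) (s + z^*).
Proof.
rewrite rmorph_prod; elim: zs => [|z zs IH]; first by rewrite !big_nil mulr1.
by rewrite !big_cons IH /= rmorphB rmorphN /= conjcK exprS; ring.
Qed.

(** * Stability and one Euclidean step *)

Definition hurwitz_stable (R : rcfType) (f : {poly R[i]}) : Prop :=
  forall s, root f s -> complex.Re s < 0.

(** With F, G the products of [paraconj_prod_ineq] over the roots of P0 + P1, one has P0 + P1 = a0
    F, and paraconjugation gives P0 - P1 = a0 G. Hence F - G is 2 P1 / a0, and |F|^2 - |G|^2 is 4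
    [dotc] P0 P1 / a0^2. *)
Lemma hurwitz_stable_pair_ineq (R : rcfType) (m : nat) (P0 P1 : {poly R[i]}) (a0 a1 : R) :
  0 < a0 -> (size P0 <= m.+2)%N -> P0`_m.+1 = a0%:C ->
  (size P1 <= m.+1)%N -> P1`_m = a1%:C ->
  para_sym m.+1 P0 -> para_sym m P1 -> hurwitz_stable (P0 + P1) ->
  0 < a1 /\ forall s, 0 <= complex.Re s ->
    a0 * (complex.Re s * dotc P1.[s] P1.[s]) <= a1 * dotc P0.[s] P1.[s].
Proof.
move=> a0p sz0 l0 sz1 l1 y0 y1 st.
have lm : (P0 + P1)`_m.+1 = a0%:C.
  by rewrite coefD l0 [P1`__]nth_default // addr0.
have a0n : a0%:C != 0 :> R[i] by rewrite fmorph_eq0 gt_eqF.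
have sz : size (P0 + P1) = m.+2.
  apply/eqP; rewrite eqn_leq; apply/andP; split.
    by rewrite (leq_trans (size_polyD _ _)) // geq_max sz0 (leq_trans sz1).
  by rewrite ltnNge; apply/negP => h; move: a0n; rewrite -lm nth_default ?eqxx.
have [zs ef] := closed_field_poly_normal (P0 + P1).
have el : lead_coef (P0 + P1) = a0%:C by rewrite lead_coefE sz.
rewrite el in ef.
have szs : size zs = m.+1.
  by move: sz; rewrite ef size_scale // size_prod_XsubC => -[].
have hz z : z \in zs -> complex.Re z < 0.
  by move=> h; apply: st; rewrite ef rootZ // root_prod_XsubC.
(* Vieta in real parts: by symmetry the degree-m coefficient of [P0] is purely imaginary. *)
have ea : a1 = a0 * - \sum_(z <- zs) complex.Re z.
  have re0 : complex.Re (P0`_m) = 0.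
    have := y0 m; rewrite -signr_odd addSn oddS oddD addbb /= expr1 mulN1r.
    by case: (P0`_m) => u v /= -[] *; lra.
  have := @coefPn_prod_XsubC _ zs; rewrite szs => /(_ isT) /= h.
  have : complex.Re ((P0 + P1)`_m) = a1 by rewrite coefD l1 raddfD /= re0 add0r.
  rewrite ef coefZ h => <-.
  by rewrite -raddf_sum; case: (\sum_(z <- zs) z) => u v /=; ring.
have Ap : 0 < - \sum_(z <- zs) complex.Re z.
  case: zs szs hz {ef ea} => // z zs _ hz; rewrite big_cons.
  have : \sum_(z <- zs) complex.Re z <= 0.
    rewrite big_seq sumr_le0 // => x hx; apply/ltW/hz.
    by rewrite inE hx orbT.
  by have := hz z (mem_head _ _); lra.
split=> [|s s0]; first by rewrite ea mulr_gt0.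
have [_ _] := paraconj_prod_ineq hz s0.
set F := \prod_(z <- zs) _; set G := \prod_(z <- zs) _ => hFG.
have eF : P0.[s] + P1.[s] = a0%:C * F.
  rewrite -hornerD ef hornerZ horner_prod; congr (_ * _).
  by apply: eq_bigr => z _; rewrite hornerXsubC.
have eG : P0.[s] - P1.[s] = a0%:C * G.
  have : ((P0 + P1).[- s^*])^* = (-1) ^+ m.+1 * (a0%:C * G).
    have cM (x : R) (u : R[i]) : (x%:C * u)^* = x%:C * u^*.
      by case: u => u1 u2; simpc.
    rewrite ef hornerZ horner_prod cM mulrCA; congr (_ * _).
    rewrite -szs -paraconj_prod; congr (_^*).
    by apply: eq_bigr => z _; rewrite hornerXsubC.
  rewrite hornerD rmorphD /= (para_sym_horner _ y0) (para_sym_horner _ y1).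
  move=> h; apply: (mulfI (negbT (signr_eq0 _ m.+1))); rewrite -h exprS; ring.
rewrite ea; move: eF eG hFG {ef}.
move: (- \sum_(z <- zs) _) P0.[s] P1.[s] F G (complex.Re s) => A.
move=> [p1 p2] [q1 q2] [f1 f2] [g1 g2] x; simpc; rewrite /dotc /=.
move=> [e1 e2] [e3 e4].
have -> : p1 = a0 * (f1 + g1) / 2 by lra.
have -> : p2 = a0 * (f2 + g2) / 2 by lra.
have -> : q1 = a0 * (f1 - g1) / 2 by lra.
have -> : q2 = a0 * (f2 - g2) / 2 by lra.
(* The quadratic forms give a0^2 / 4; one more a0 is explicit on the left and comes from a1 = a0 A
   on the right. *)
move=> h; have a3 : 0 <= a0 ^+ 3 / 4 by rewrite divr_ge0 // exprn_ge0 // ltW.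
have := ler_wpM2l a3 h; lra.
Qed.

Lemma hurwitz_stable_step (R : rcfType) (m : nat) (P0 P1 P2 : {poly R[i]})
    (a0 a1 be : R) :
  0 < a0 -> (size P0 <= m.+2)%N -> P0`_m.+1 = a0%:C ->
  (size P1 <= m.+1)%N -> P1`_m = a1%:C ->
  para_sym m.+1 P0 -> para_sym m P1 -> para_sym m.+1 P2 ->
  (a1 ^+ 2)%:C *: P0 = P2 + ((a1 * a0)%:C *: 'X + (be *i)%:P) * P1 ->
  hurwitz_stable (P0 + P1) -> hurwitz_stable (P1 + P2).
Proof.
move=> a0p sz0 l0 sz1 l1 y0 y1 y2 rec st.
have [a1p W] := hurwitz_stable_pair_ineq a0p sz0 l0 sz1 l1 y0 y1 st.
move=> s /rootP hs; rewrite ltNge; apply/negP => s0.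
have recs : (a1 ^+ 2)%:C * P0.[s] = P2.[s] + ((a1 * a0)%:C * s + be *i) * P1.[s].
  by rewrite -hornerZ rec !hornerE.
(* By the recurrence a common zero of P1 and P2 is a zero of P0, against stability of P0 + P1. *)
suff [z1 z2] : P1.[s] = 0 /\ P2.[s] = 0.
  have z0 : P0.[s] = 0.
    move: recs; rewrite z1 z2 mulr0 addr0 => /eqP; rewrite mulf_eq0 fmorph_eq0.
    by rewrite expf_eq0 (gt_eqF a1p) andbF => /eqP.
  have : root (P0 + P1) s by rewrite /root hornerD z0 z1 addr0.
  by move/st; rewrite ltNge s0.
move: hs; rewrite hornerD => hs.
move: s0; rewrite le_eqVlt => /orP[/eqP s0|s0].
  exact: (para_sym_axis y1 y2 (esym s0) hs).
(* As P2 = - P1 at s, pairing the recurrence with P1 gives a1^2 [dotc] P0 P1 = (a1 a0 Re s - 1)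
   |P1|^2, whereas [W] bounds the left side below by a1 a0 Re s |P1|^2. So |P1|^2 <= 0. *)
have z1 : P1.[s] = 0.
  apply: dotc_le0; have := W _ (ltW s0).
  have := a1p; move: recs hs s0 {W}; move: P0.[s] P1.[s] P2.[s] => [p1 p2] [q1 q2] [r1 r2].
  case: s => x y; rewrite /dotc; simpc => -[e1 e2] [h1 h2] /= x0 a1p' h.
  have h' := ler_wpM2l (ltW a1p) h.
  have er1 : r1 = - q1 by lra.
  have er2 : r2 = - q2 by lra.
  rewrite er1 er2 in e1 e2.
  have f1 : a1 ^+ 2 * p1 * q1 = (- q1 + (a1 * a0 * x * q1 - (a1 * a0 * y + be) * q2)) * q1.
    by rewrite e1; ring.
  have f2 : a1 ^+ 2 * p2 * q2 = (- q2 + (a1 * a0 * x * q2 + (a1 * a0 * y + be) * q1)) * q2.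
    by rewrite e2; ring.
  nra.
by split=> //; move: hs; rewrite z1 add0r.
Qed.

(** * Positivity and stability along the chain of remainders *)

Lemma para_symSS (R : rcfType) (e : nat) (f : {poly R[i]}) :
  para_sym e f -> para_sym e.+2 f.
Proof. by move=> hf i; rewrite hf !addSn !exprS; ring. Qed.

Lemma hurwitz_stable_of_chain (R : rcfType) (n : nat)
    (P : nat -> {poly R[i]}) (al be : nat -> R) :
  (forall p, (p <= n.+1)%N -> 0 < al p) ->
  (forall p, (p <= n.+1)%N -> (size (P p) <= (n.+1 - p).+1)%N) ->
  (forall p, (p <= n.+1)%N -> (P p)`_(n.+1 - p) = (al p)%:C) ->
  (forall p, (p <= n.+1)%N -> para_sym (n.+1 - p) (P p)) ->
  (forall p, (p.+2 <= n.+1)%N ->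
    (al p.+1 ^+ 2)%:C *: P p =
      P p.+2 + ((al p.+1 * al p)%:C *: 'X + ((be p.+1)*i)%:P) * P p.+1) ->
  hurwitz_stable (P 0%N + P 1%N).
Proof.
move=> alp sz lc sy rec s /rootP hs; rewrite ltNge; apply/negP => s0.
have recs p : (p.+2 <= n.+1)%N -> (al p.+1 ^+ 2)%:C * (P p).[s] =
    (P p.+2).[s] + ((al p.+1 * al p)%:C * s + (be p.+1)*i) * (P p.+1).[s].
  by move=> /rec h; rewrite -hornerZ h !hornerE.
have Pn : (P n.+1).[s] = (al n.+1)%:C.
  have := sz _ (leqnn n.+1); have := lc _ (leqnn n.+1); rewrite subnn => l1 s1.
  by rewrite (size1_polyC s1) hornerC l1.
move: hs; rewrite hornerD => hs.
move: s0; rewrite le_eqVlt => /orP[/eqP s0|s0].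
  have sy1 := sy 1%N isT; rewrite subSS subn0 in sy1.
  have sy0 := sy 0%N isT; rewrite subn0 in sy0.
  rewrite addrC in hs.
  have [z1 z0] := para_sym_axis sy1 sy0 (esym s0) hs.
  have z p : (p <= n)%N -> (P p).[s] = 0 /\ (P p.+1).[s] = 0.
    elim: p => [//|p IH] hp; have [u v] := IH (ltnW hp); split=> //.
    by have := recs p hp; rewrite u v !mulr0 addr0.
  have [_] := z n (leqnn n); rewrite Pn => /eqP; rewrite fmorph_eq0.
  by rewrite (gt_eqF (alp _ (leqnn _))).
have W j p : (p + j)%N = n -> 0 < dotc (P p).[s] (P p.+1).[s].
  elim: j p => [|j IH] p hp.
    (* P_n is linear with imaginary constant term, so its pairing with the constant P_(n+1) is al_n
       al_(n+1) Re s. *)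
    rewrite addn0 in hp; subst p; rewrite Pn.
    have := sz n (leqnSn n); have := lc n (leqnSn n); have := sy n (leqnSn n).
    rewrite subSnn => sy1 l1 s1; rewrite (horner_coef_wide _ s1).
    rewrite big_ord_recr big_ord1 /= expr0 expr1 mulr1 l1.
    have := sy1 0%N; case: ((P n)`_0) s s0 {s1 l1 sy1 recs Pn hs} => u v [x y] /= x0.
    rewrite expr1 mulN1r => -[hu].
    rewrite /dotc /=; simpc => /=.
    have -> : u = 0 by lra.
    by rewrite add0r !mulr_gt0 ?alp.
  have hp2 : (p.+2 <= n.+1)%N by lia.
  have := IH p.+1 ltac:(lia); have := recs p hp2.
  have a1 := alp p.+1 (ltnW hp2); have a0 := alp p ltac:(lia).
  move: (P p).[s] (P p.+1).[s] (P p.+2).[s] => [p1 p2] [q1 q2] [r1 r2].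
  case: s s0 {recs Pn hs IH} => x y /= x0; simpc; rewrite /dotc /= => -[e1 e2] h.
  (* What the linear factor contributes when the recurrence is paired with P_(p+1); its imaginary
     part drops out. *)
  have hq : 0 <= al p.+1 * al p * x * (q1 ^+ 2 + q2 ^+ 2).
    by rewrite !mulr_ge0 ?addr_ge0 ?sqr_ge0 // ltW.
  rewrite -(pmulr_rgt0 _ (exprn_gt0 2 a1)).
  have -> : al p.+1 ^+ 2 * (p1 * q1 + p2 * q2) =
      (al p.+1 ^+ 2 * p1) * q1 + (al p.+1 ^+ 2 * p2) * q2 by ring.
  by rewrite e1 e2; lra.
(* At a root this pairing would equal - |P_1|^2. *)
have := W n 0%N (add0n n).
have -> : (P 0%N).[s] = - (P 1%N).[s] by apply/eqP; rewrite -addr_eq0 hs.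
have := dotc_ge0 (P 1%N).[s]; case: (P 1%N).[s] => u v; rewrite /dotc /=; lra.
Qed.

Lemma chain_gt0_of_hurwitz_stable (R : rcfType) (n : nat)
    (P : nat -> {poly R[i]}) (al be : nat -> R) :
  0 < al 0%N ->
  (forall p, (p <= n.+1)%N -> (size (P p) <= (n.+1 - p).+1)%N) ->
  (forall p, (p <= n.+1)%N -> (P p)`_(n.+1 - p) = (al p)%:C) ->
  (forall p, (p <= n.+1)%N -> para_sym (n.+1 - p) (P p)) ->
  (forall p, (p.+2 <= n.+1)%N ->
    (al p.+1 ^+ 2)%:C *: P p =
      P p.+2 + ((al p.+1 * al p)%:C *: 'X + ((be p.+1)*i)%:P) * P p.+1) ->
  hurwitz_stable (P 0%N + P 1%N) ->
  forall p, (p <= n.+1)%N -> 0 < al p.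
Proof.
move=> al0 sz lc sy rec st.
have e p : (p <= n)%N -> (n.+1 - p = (n.+1 - p.+1).+1)%N by lia.
have pos p : (p <= n)%N -> 0 < al p -> hurwitz_stable (P p + P p.+1) ->
    0 < al p.+1.
  move=> hp ap stp; have hp' : (p <= n.+1)%N by apply: leqW.
  have := sz p hp'; have := lc p hp'; have := sy p hp'; rewrite e // => y0 l0 z0.
  exact: (hurwitz_stable_pair_ineq ap z0 l0 (sz p.+1 hp) (lc p.+1 hp) y0 (sy p.+1 hp) stp).1.
have I p : (p <= n)%N -> 0 < al p /\ hurwitz_stable (P p + P p.+1).
  elim: p => [//|p IH] hp; have [ap stp] := IH (ltnW hp).
  split; first exact: pos (ltnW hp) ap stp.
  have hp' : (p <= n.+1)%N by lia.
  have := sz p hp'; have := lc p hp'; have := sy p hp'.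
  rewrite e ?(ltnW hp) // => y0 l0 z0.
  have y2 : para_sym (n.+1 - p.+1).+1 (P p.+2).
    have := para_symSS (sy p.+2 hp); congr (para_sym _ _); lia.
  exact: (hurwitz_stable_step ap z0 l0 (sz p.+1 (ltnW hp)) (lc p.+1 (ltnW hp)) y0
    (sy p.+1 (ltnW hp)) y2 (rec p hp) stp).
(* [I] stops at n, the last index with a successor in the chain; [pos] supplies al_(n+1). *)
case=> [//|p] hp; have [ap stp] := I p hp; exact: pos.
Qed.

(** * The table as a chain of Euclidean remainders *)

Section Table.
Variables (R : realType) (n : nat) (a b : nat -> R).

Let A p k := (rh_table n a b p).1 k.
Let B p k := (rh_table n a b p).2 k.

Lemma rh_tableSS p : rh_table n a b p.+2 = rh_step n p.+2 (rh_table n a b p.+1).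
Proof. by []. Qed.

Lemma rh_table_support p k : ~~ (p.+1 <= k <= n)%N -> A p.+1 k = 0 /\ B p.+1 k = 0.
Proof.
rewrite /A /B; case: p => [|p] /negbTE h.
  by rewrite /= /trunc_seq h.
by rewrite rh_tableSS /rh_step; case: rh_table => u v; rewrite /= /trunc_seq h.
Qed.

(** The entry at k + 1 has the other parity, so it lies in the first row and may be read off the
    table itself. *)
Lemma rh_table_even p k : (p.+2 <= k <= n)%N -> odd k = odd p ->
  A p.+2 k = A p.+1 p.+1 * A p.+1 k + B p.+1 p.+1 * B p.+1 k /\
  B p.+2 k = A p.+2 p.+2 * B p.+1 k - A p.+1 p.+1 * B p.+2 k.+1.
Proof.
move=> h e; have h2 : (p.+2 <= p.+2 <= n)%N by case/andP: h => *; apply/andP; lia.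
have e' : (odd k.+1 == odd p.+2) = false by rewrite /= negbK e; case: (odd p).
have e1 : (odd k == odd p.+2) by rewrite /= negbK e.
rewrite /A /B rh_tableSS /rh_step; case: rh_table => u v /=.
move: e' e1 => /= e' e1.
rewrite /trunc_seq h h2 e1 eqxx e' /=; split=> //.
by case: ifP.
Qed.

Lemma rh_table_odd p k : (p.+2 <= k <= n)%N -> odd k = ~~ odd p ->
  B p.+2 k = A p.+1 p.+1 * B p.+1 k - B p.+1 p.+1 * A p.+1 k /\
  A p.+2 k = A p.+2 p.+2 * A p.+1 k - A p.+1 p.+1 * A p.+2 k.+1.
Proof.
move=> h e; have h2 : (p.+2 <= p.+2 <= n)%N by case/andP: h => *; apply/andP; lia.
have e' : (odd k.+1 == odd p.+2) by rewrite /= negbK e negbK.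
have e1 : (odd k == odd p.+2) = false by rewrite /= negbK e; case: (odd p).
rewrite /A /B rh_tableSS /rh_step; case: rh_table => u v /=.
move: e' e1 => /= e' e1.
rewrite /trunc_seq h h2 e1 eqxx e' /=; split=> //.
by case: ifP.
Qed.

Definition rh_lead p : R := if p is 0 then 1 else A p p.

(* [rh_row1 p k] is the coefficient of s^(n-k) in the p-th remainder P_p;
   row 0 is the part of q complementary to row 1. *)
Definition rh_row1 p k : R[i] :=
  if p is 0 then
    if k is 0 then 1 else
    if odd k then (trunc_seq 1 n b k)*i else (trunc_seq 1 n a k)%:C
  else if odd k == odd p then (A p k)%:C else (B p k)*i.

(** For p >= 1, the coefficients of the half-reduced remainder al_p P_(p-1) - al_(p-1) s P_p. *)
Definition rh_row2 p k : R[i] :=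
  if odd k == odd p then (B p k)*i else (A p k)%:C.

Lemma rh_row1_lead p : rh_row1 p p = (rh_lead p)%:C.
Proof. by case: p => //= p; rewrite eqxx. Qed.

Lemma rh_row1_eq0 p k : ~~ (p <= k <= n)%N -> rh_row1 p k = 0.
Proof.
case: p => [|p] h; last first.
  by have [h1 h2] := rh_table_support h; rewrite /rh_row1 h1 h2; case: ifP.
case: k h => [//|k] /negbTE /= h.
by rewrite /rh_row1 /trunc_seq /= h; case: ifP.
Qed.

Lemma rh_row2_eq0 p k : ~~ (p.+1 <= k <= n)%N -> rh_row2 p.+1 k = 0.
Proof.
by move=> h; have [h1 h2] := rh_table_support h; rewrite /rh_row2 h1 h2; case: ifP.
Qed.

Lemma rh_row1_rec p k : (p.+2 <= n)%N ->
  rh_row1 p.+2 k =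
    (A p.+1 p.+1)%:C * rh_row2 p.+1 k - (B p.+1 p.+1)*i * rh_row1 p.+1 k.
Proof.
move=> hp; case: (boolP (p.+2 <= k <= n)%N) => h; last first.
  rewrite (rh_row1_eq0 h).
  (* In this column the leading terms cancel, matching the truncated left side. *)
  have [->|ne] := eqVneq k p.+1.
    by rewrite /rh_row1 /rh_row2 eqxx; simpc; rewrite mulrC subrr.
  have h' : ~~ (p.+1 <= k <= n)%N by apply: contra h => /andP[? ->]; rewrite andbT ltn_neqAle eq_sym ne.
  by rewrite (rh_row1_eq0 h') (rh_row2_eq0 h') !mulr0 subr0.
rewrite /rh_row1 /rh_row2; have [e|e] := boolP (odd k == odd p).
  have [-> _] := rh_table_even h (eqP e).
  by rewrite /= (eqP e) negbK eqxx; case: (odd p) => /=; simpc.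
have e' : odd k = ~~ odd p by case: (odd k) (odd p) e => [] [].
have [-> _] := rh_table_odd h e'.
by rewrite /= e' negbK eqxx; case: (odd p) => /=; simpc.
Qed.

Lemma rh_row2_rec p k : (p.+1 <= n)%N ->
  rh_row2 p.+1 k =
    (rh_lead p.+1)%:C * rh_row1 p k - (rh_lead p)%:C * rh_row1 p.+1 k.+1.
Proof.
move=> hp; case: (boolP (p.+1 <= k <= n)%N) => h; last first.
  rewrite (rh_row2_eq0 h).
  have [->|ne] := eqVneq k p.
    by rewrite !rh_row1_lead mulrC subrr.
  have h1 : ~~ (p <= k <= n)%N by apply: contra h => /andP[? ->]; rewrite andbT ltn_neqAle eq_sym ne.
  have h2 : ~~ (p.+1 <= k.+1 <= n)%N.
    by apply: contra h1 => /andP[? ?]; apply/andP; lia.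
  by rewrite (rh_row1_eq0 h1) (rh_row1_eq0 h2) !mulr0 subr0.
case: p hp h => [|p] hp h.
  (* The initialization, read with al_0 = 1; splitting on [(k.+1 < n)%N] accounts for a_(n+1) =
     b_(n+1) = 0. *)
  have k0 : (k == 0)%N = false by case/andP: h; case: k.
  have k1 : (1 <= k.+1)%N by [].
  rewrite /rh_row2 /rh_row1 /rh_lead /A /B /= /trunc_seq h hp /=.
  case: k k0 h {k1} => //= k _ h; rewrite !negbK.
  by case: (odd k); case: (k.+1 < n)%N => /=; simpc.
rewrite /rh_row1 /rh_row2 /rh_lead; have [e|e] := boolP (odd k == odd p).
  have [_ ->] := rh_table_even h (eqP e).
  by rewrite /= (eqP e) negbK eqxx; case: (odd p) => /=; simpc.
have e' : odd k = ~~ odd p by case: (odd k) (odd p) e => [] [].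
have [_ ->] := rh_table_odd h e'.
by rewrite /= e' negbK eqxx; case: (odd p) => /=; simpc.
Qed.

Definition rh_poly p : {poly R[i]} := \poly_(i < n.+1) rh_row1 p (n - i).

Lemma coef_rh_poly p i : (i <= n)%N -> (rh_poly p)`_i = rh_row1 p (n - i).
Proof. by rewrite coef_poly ltnS => ->. Qed.

(** Eliminating [rh_row2] between its recurrence and that of [rh_row1] merges two half-steps into
    one division. *)
Lemma rh_poly_rec p : (p.+2 <= n)%N ->
  (rh_lead p.+1 ^+ 2)%:C *: rh_poly p = rh_poly p.+2 +
    ((rh_lead p.+1 * rh_lead p)%:C *: 'X + ((B p.+1 p.+1)*i)%:P) * rh_poly p.+1.
Proof.
move=> hp; have hp' := ltnW hp.
have rec k : (rh_lead p.+1 ^+ 2)%:C * rh_row1 p k = rh_row1 p.+2 k +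
    ((rh_lead p.+1 * rh_lead p)%:C * rh_row1 p.+1 k.+1
     + (B p.+1 p.+1)*i * rh_row1 p.+1 k).
  by rewrite rh_row1_rec // rh_row2_rec // [A _ _]/(rh_lead p.+1) !rmorphM /=; ring.
apply/polyP => i; rewrite coefZ coefD mulrDl coefD -scalerAl coefZ coefCM.
rewrite (mulrC 'X) coefMX.
case: i => [|i] /=.
  rewrite !coef_rh_poly // subn0 rec mulr0 add0r.
  by rewrite (@rh_row1_eq0 p.+1 n.+1) ?ltnn ?andbF // mulr0 add0r.
have [hi|hi] := leqP i.+1 n.
  rewrite !coef_rh_poly ?(ltnW hi) // rec.
  by have -> : (n - i.+1).+1 = (n - i)%N by lia.
have hn0 q : (rh_poly q)`_i.+1 = 0 by rewrite coef_poly ltnS leqNgt hi.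
rewrite !hn0 !mulr0 add0r addr0 coef_poly; case: ifP => hh; last by rewrite mulr0.
(* Multiplication by s could reach degree n + 1 only through column 0 of row p + 1, which is
   zero. *)
by rewrite rh_row1_eq0 ?mulr0 //; apply/negP => /andP[]; lia.
Qed.

Lemma size_rh_poly p : (p <= n)%N -> (size (rh_poly p) <= (n - p).+1)%N.
Proof.
move=> hp; apply/leq_sizeP => j hj; rewrite coef_poly; case: ifP => // hh.
by rewrite rh_row1_eq0 //; apply/negP => /andP[]; lia.
Qed.

Lemma para_sym_rh_poly p : (p <= n)%N -> para_sym (n - p) (rh_poly p).
Proof.
move=> hp i; rewrite coef_poly; case: ifP => hi; last by rewrite mulr0 rmorph0.
(* The sign is expressed through the column n - i, whose parity decides whether the entry is
   real. *)
have -> : (-1) ^+ (n - p + i) = (-1) ^+ (p + (n - i)) :> R[i].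
  rewrite -signr_odd -[RHS]signr_odd !oddD !oddB //.
  by congr (_ ^+ nat_of_bool _); case: (odd n) (odd p) (odd i) => [] [] [].
rewrite -signr_odd oddD; case: p {hp} => [|p] /=.
  case: (n - i)%N => [|k] /=; first by rewrite expr0 mul1r; simpc.
  by case: (odd k) => /=; rewrite ?expr0 ?expr1; simpc.
by case: (odd (n - i)) (odd p) => [] [] /=; rewrite ?expr0 ?expr1; simpc.
Qed.

Lemma rh_polyD : (0 < n)%N -> rh_poly 0 + rh_poly 1 = poly_of_coefs n a b.
Proof.
move=> n0; apply/polyP => i; rewrite /poly_of_coefs !coefD coefXn coef_sum.
rewrite !coef_poly ltnS.
have [hi|hi] := leqP i n; last first.
  rewrite gtn_eqF // big_nat big1 ?addr0 // => j /andP[j1 j2].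
  by rewrite coefZ coefXn gtn_eqF ?mulr0 //; lia.
have [->|ni] := eqVneq i n.
  rewrite subnn big_nat big1 => [|j /andP[j1 j2]]; last first.
    by rewrite coefZ coefXn gtn_eqF ?mulr0 //; lia.
  by rewrite (@rh_row1_eq0 1%N 0%N) // addr0.
rewrite (bigD1_seq (n - i)%N) ?iota_uniq //=; last by rewrite mem_index_iota; lia.
rewrite big_nat_cond big1 => [|j /andP[/andP[j1 j2] j3]]; last first.
  by rewrite coefZ coefXn [_ == _]negbTE ?mulr0 //; lia.
rewrite coefZ coefXn subKn // eqxx mulr1 addr0 add0r.
have: (1 <= n - i <= n)%N by lia.
(* In each column one of rows 0 and 1 holds a_k and the other i b_k. *)
move: (n - i)%N => k hk; rewrite /rh_row1 /A /B /= /trunc_seq hk.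
by case: k hk => //= k hk; rewrite ?hk ?n0 /=; case: (odd k) => /=; simpc.
Qed.

End Table.

Theorem mainTheorem1 (R : realType) (n : nat) (hn : (2 <= n)%N)
    (a b : nat -> R) :
  (forall s : R[i], root (poly_of_coefs n a b) s -> complex.Re s < 0) <->
  (forall k : nat, (1 <= k <= n)%N -> 0 < rh_a n a b k k).
Proof.
case: n hn => // n _; rewrite -rh_polyD //.
pose P := rh_poly n.+1 a b; pose al := rh_lead n.+1 a b.
pose be p := (rh_table n.+1 a b p).2 p.
have sz p : (p <= n.+1)%N -> (size (P p) <= (n.+1 - p).+1)%N.
  exact: size_rh_poly.
have lc p : (p <= n.+1)%N -> (P p)`_(n.+1 - p) = (al p)%:C.
  by move=> hp; rewrite coef_rh_poly ?leq_subr // subKn // rh_row1_lead.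
have sy p : (p <= n.+1)%N -> para_sym (n.+1 - p) (P p).
  exact: para_sym_rh_poly.
have rec p : (p.+2 <= n.+1)%N -> (al p.+1 ^+ 2)%:C *: P p =
    P p.+2 + ((al p.+1 * al p)%:C *: 'X + ((be p.+1)*i)%:P) * P p.+1.
  exact: rh_poly_rec.
have al0 : 0 < al 0%N by apply: ltr01.
split=> [st k /andP[k1 k2]|h].
  have := chain_gt0_of_hurwitz_stable al0 sz lc sy rec st k2.
  by case: k k1 k2.
apply: (hurwitz_stable_of_chain _ sz lc sy rec) => -[|p] hp //.
exact: h.
Qed.
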